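(* Let $p>3$ be a prime. Then \begin{align*} \pounds_2(1\pm i)&\equiv -\frac{q_p(2)^2}{8}\left(1\pm i\left(\frac{-1}{p}\right)\right)+\frac{1}{2}\left(\frac{-1}{p}\right)E_{p-3} \pmod{p},\\ \pounds_2\bigl((1\pm i)/2\bigr)&\equiv -\frac{q_p(2)^2}{8}+\frac{1}{4}\left(\left(\frac{-1}{p}\right)\pm i\right)E_{p-3} \pmod{p}. \end{align*}
   Context: For a prime $p$ and a positive integer $d$, the finite polylogarithm is $\pounds_d(x)=\sum_{k=1}^{p-1} x^k/k^d$. $q_p(a)=(a^{p-1}-1)/p$ is the Fermat quotient. $E_n$ denotes the $n$-th Euler number and $\left(\frac{\cdot}{p}\right)$ the Legendre symbol. Congruences modulo $p$ are taken in the ring of elements of $\mathbb{Q}(i)$ that are integral at all primes above $p$: $a\equiv b\pmod p$ means $(a-b)/p$ is such an element. *)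

(* Defs.v *)
From HB Require Import structures.
From mathcomp Require Import all_boot all_order all_algebra all_field.

Set Implicit Arguments.
Unset Strict Implicit.
Unset Printing Implicit Defensive.

Import Order.TTheory GRing.Theory Num.Theory.
Local Open Scope ring_scope.

Definition finite_polylog (F : fieldType) (p d : nat) (x : F) : F :=
  \sum_(1 <= k < p) x ^+ k / k%:R ^+ d.

Definition fermat_quotient (F : fieldType) (p : nat) (a : int) : F :=
  (a%:~R ^+ p.-1 - 1) / p%:R.

(* Meaningful for p prime, where 'F_p is the field with p elements. *)
Definition legendre (a : int) (p : nat) : int :=
  if (a%:~R : 'F_p) == 0 then 0
  else if [exists x : 'F_p, x ^+ 2 == a%:~R] then 1 else -1.

(* The Euler numbers with exponential generating function 1 / cosh t
   (1, 0, -1, 0, 5, 0, -61, ...): the recurrence compares coefficients of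
   t ^ n in cosh t * \sum_n E_n t ^ n / n! = 1 (see euler_sum below). *)
Fixpoint euler_upto (n : nat) : seq int :=
  if n is m.+1 then
    let s := euler_upto m in
    rcons s (- \sum_(k < n | ~~ odd (n - k)) 'C(n, k)%:Z * s`_k)
  else [:: 1].

Definition euler (n : nat) : int := (euler_upto n)`_n.

Lemma size_euler_upto n : size (euler_upto n) = n.+1.
Proof. by elim: n => //= n IHn; rewrite size_rcons IHn. Qed.

Lemma nth_euler_upto n k : (k <= n)%N -> (euler_upto n)`_k = euler k.
Proof.
elim: n => [|n IHn]; first by rewrite leqn0 => /eqP->.
rewrite leq_eqVlt => /predU1P[-> //|lt_kn].
by rewrite /= nth_rcons size_euler_upto lt_kn IHn.
Qed.

Lemma euler_sum n :
  \sum_(k < n.+1 | ~~ odd (n - k)) 'C(n, k)%:Z * euler k = (n == 0%N)%:Z.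
Proof.
rewrite big_mkcond big_ord_recr /= -big_mkcond /= subnn binn mul1r /=.
case: n => [|n]; first by rewrite big1 ?add0r // => -[].
rewrite {2}/euler /= nth_rcons size_euler_upto ltnn eqxx.
rewrite [X in X - _](_ : _ = \sum_(k < n.+1 | ~~ odd (n.+1 - k))
  'C(n.+1, k)%:Z * (euler_upto n)`_k) ?subrr //.
by apply: eq_bigr => k _; rewrite nth_euler_upto // -ltnS.
Qed.

(* The field Q(i), inside algC. *)
Definition gauss_rat : {pred algC} :=
  fun z => ('Re z \in Crat) && ('Im z \in Crat).

(* The ring of integers Z[i] of Q(i). *)
Definition gauss_int_pred : {pred algC} :=
  fun z => ('Re z \in Num.int) && ('Im z \in Num.int).

Fact gauss_int_subring : subring_closed gauss_int_pred.
Proof.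
split=> [|x y /andP[xR xI] /andP[yR yI]|x y /andP[xR xI] /andP[yR yI]].
- by apply/andP; rewrite (Creal_ReP _ _) ?(Creal_ImP _ _) ?rpred1 ?rpred0.
- by apply/andP; split; rewrite raddfB rpredB.
- by apply/andP; split; rewrite ?ReM ?ImM (rpredB, rpredD) // rpredM.
Qed.

HB.instance Definition _ :=
  GRing.isSubringClosed.Build algC gauss_int_pred gauss_int_subring.

Record gauss_int := GaussInt {
  gauss_int_val :> algC;
  _ : gauss_int_val \in gauss_int_pred }.

HB.instance Definition _ := [isSub for gauss_int_val].
HB.instance Definition _ := [Choice of gauss_int by <:].
HB.instance Definition _ := [SubChoice_isSubComNzRing of gauss_int by <:].

(* z lies in the localization of Z[i] at the prime ideal P. *)
Definition integral_at (P : prime_idealr gauss_int) (z : algC) : Prop :=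
  exists a b : gauss_int, b \notin P /\ z = (a : algC) / (b : algC).

Definition integral_above (p : nat) (z : algC) : Prop :=
  z \in gauss_rat /\
  forall P : prime_idealr gauss_int, p%:R \in P -> integral_at P z.

Definition eqmod_above (p : nat) (a b : algC) : Prop :=
  integral_above p ((a - b) / p%:R).

(* Main.v *)
From HB Require Import structures.
Require Import Defs.
From mathcomp Require Import all_boot all_order all_algebra all_field.
From mathcomp Require Import all_solvable ring zify.
Import Order.TTheory GRing.Theory Num.Theory.
Local Open Scope ring_scope.

(* Everything is computed in K = Z[i]/(p), where 1/k^d becomes k^(p-1-d), so that
   the finite polylogarithms are polynomials L (d = 1) and G (d = 2) over K.
   Comparing derivatives and the values at 0 and 1 gives L(1 - x) = L(x) and
   Granville's identity L(x)^2 = -2 (x^p G(x) + (1 - x^p) G(1 - x)). At x = 1 + J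
   with J^2 = -1 this expresses G(1 + J) through L(-J) and G(-J). The former is a
   multiple of the Fermat quotient of 2, as seen by squaring the binomial
   expansion of (1 + J)^p modulo p^2. The latter follows from
   G(J) = (-1/p) J G(-J) and G(J) + G(-J) = (-1/p) E_(p-3); this last relation is
   the functional equation of the Euler polynomials summed from 1 to p. Inversion
   x -> 1/x then gives the values at (1 + J)/2. *)

(** * Elementary facts about primes and Frobenius *)

Lemma prime_gt3_odd p : prime p -> (3 < p)%N -> odd p.
Proof. by move=> /even_prime[->|]. Qed.

Lemma odd_half_doubleS p : odd p -> p = p./2.*2.+1.
Proof. by move=> p_odd; rewrite -{1}[p]odd_double_half p_odd. Qed.

Lemma exprD_pchar (R : comNzRingType) (p : nat) (x y : R) :
  p \in [pchar R] -> (x + y) ^+ p = x ^+ p + y ^+ p.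
Proof.
move=> pR; have := pFrobenius_autD_comm pR (mulrC x y).
by rewrite !pFrobenius_autE.
Qed.

Lemma coprime_lt_prime (p k : nat) : prime p -> (0 < k < p)%N -> coprime k p.
Proof.
by move=> p_prime /andP[k0 kp]; rewrite coprime_sym prime_coprime // gtnNdvd.
Qed.

(** * Finite polylogarithms in characteristic p *)

Section CharP.
Variables (K : comNzRingType) (p : nat).
Hypothesis pcharK : p \in [pchar K].

Let p_prime : prime p. Proof. exact: pcharf_prime pcharK. Qed.

Lemma natr_pchar_eqmod (m n : nat) : m = n %[mod p] -> m%:R = n%:R :> K.
Proof.
by move=> e; rewrite (divn_eq m p) (divn_eq n p) e !natrD !natrM (pcharf0 pcharK) !mulr0.
Qed.

Lemma expr_pred_pchar_natr (k : nat) : coprime k p -> k%:R ^+ p.-1 = 1 :> K.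
Proof.
move=> cop; rewrite -natrX; apply: (natr_pchar_eqmod _ 1).
by rewrite -(Euler_exp_totient cop) totient_prime.
Qed.

(** [K] may have zero divisors, so [k] is cancelled by multiplying with its Fermat inverse
    [k ^ (p - 2)]. *)
Lemma mulrn_coprime_eq0 (k : nat) (x : K) : coprime k p -> x *+ k = 0 -> x = 0.
Proof.
move=> cop; rewrite -mulr_natl => /(congr1 ( *%R (k%:R ^+ p.-2))).
rewrite mulrA -exprSr prednK ?expr_pred_pchar_natr ?mul1r ?mulr0 //.
by have := prime_gt1 p_prime; case: (p) => [|[]].
Qed.

Lemma deriv_eq0_size_le_pchar (f : {poly K}) :
  f^`() = 0 -> (size f <= p)%N -> f = (f.[0])%:P.
Proof.
move=> f'0 szf; apply/polyP=> -[|k]; rewrite coefC horner_coef0 //=.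
have [lt_kp|le_pk] := ltnP k.+1 p; last by rewrite nth_default // (leq_trans szf).
apply: (@mulrn_coprime_eq0 k.+1); first exact: coprime_lt_prime.
by rewrite -coef_deriv f'0 coef0.
Qed.

(** Below degree [2p], a zero derivative leaves only the coefficients of 1 and [X^p]; the values at
    0 and 1 then kill both. *)
Lemma deriv_eq0_size_le_double_pchar (f : {poly K}) :
  f^`() = 0 -> (size f <= p.*2)%N -> f.[0] = 0 -> f.[1] = 0 -> f = 0.
Proof.
move=> f'0 szf f0 f1; suff f_eq : f = f`_p *: 'X^p.
  by move: f1; rewrite {1}f_eq !hornerE expr1n mulr1 => fp0; rewrite f_eq fp0 scale0r.
apply/polyP=> k; rewrite coefZ coefXn.
case: eqP => [->|/eqP kp]; rewrite ?mulr1 ?mulr0 //.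
case: k kp => [|k] kp; first by rewrite -horner_coef0.
have [lt_k2p|le_2pk] := ltnP k.+1 p.*2; last first.
  by rewrite nth_default // (leq_trans szf).
apply: (@mulrn_coprime_eq0 k.+1); last by rewrite -coef_deriv f'0 coef0.
by rewrite coprime_sym prime_coprime //; apply/dvdnP=> -[[|[|q]]] e; nia.
Qed.

(** The sum may start at [k = 0] because that term vanishes when [d < p - 1]; from [d = p - 1] on it
    would be [0 ^ 0 = 1]. *)
Definition polylogp (d : nat) : {poly K} := \poly_(k < p) k%:R ^+ (p.-1 - d).

Lemma size_polylogp d : (size (polylogp d) <= p)%N.
Proof. exact: size_poly. Qed.

Lemma mulX_deriv_polylogp2 : (3 < p)%N -> 'X * (polylogp 2)^`() = polylogp 1.
Proof.
move=> p3; apply/polyP=> k; rewrite coefXM coef_deriv !coef_poly.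
case: k => [|k]; first by rewrite prime_gt0 // expr0n (_ : (p.-1 - 1 == 0)%N = false) //; lia.
case: ifP => _; rewrite ?mul0rn //.
by rewrite -[LHS]mulr_natr -exprSr; congr (_ ^+ _); lia.
Qed.

Lemma deriv_polylogp1 : (polylogp 1)^`() = \sum_(i < p.-1) 'X^i.
Proof.
apply/polyP=> k; rewrite coef_deriv coef_poly.
rewrite (eq_bigr (fun i : 'I_p.-1 => (1%R : K) *: 'X^i)) => [|i _]; last by rewrite scale1r.
rewrite -(poly_def _ (fun=> 1)) coef_poly; have p1 := prime_gt1 p_prime.
have -> : (k.+1 < p)%N = (k < p.-1)%N by lia.
case: ifP => kp; rewrite ?mul0rn // -[LHS]mulr_natr -exprSr.
have -> : (p.-1 - 1).+1 = p.-1 by lia.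
by rewrite expr_pred_pchar_natr // coprime_lt_prime //; lia.
Qed.

Lemma mul_deriv_polylogp1 : (1 - 'X) * (polylogp 1)^`() = 1 - 'X^(p.-1).
Proof.
by rewrite deriv_polylogp1 -[in RHS]opprB subrX1 -mulNr opprB.
Qed.

Lemma horner_polylogp d x : (polylogp d).[x] = \sum_(k < p) k%:R ^+ (p.-1 - d) * x ^+ k.
Proof. by rewrite horner_poly. Qed.

Lemma horner_polylogp0 d : (d.+1 < p)%N -> (polylogp d).[0] = 0.
Proof.
move=> dp; rewrite horner_coef0 coef_poly prime_gt0 // expr0n.
by rewrite (_ : (p.-1 - d == 0)%N = false) //; lia.
Qed.

Lemma natr_sub_pchar k : (k <= p)%N -> (p - k)%:R = - k%:R :> K.
Proof. by move=> kp; rewrite natrB // (pcharf0 pcharK) sub0r. Qed.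

(** Reverse the sum by [k -> p - k]: since [p - 1] is even, the coefficient only gains the sign
    [(-1)^d], and [x^(p-k) = x^p y^k]. *)
Lemma polylogp_inversion d x y : (d.+1 < p)%N -> x * y = 1 -> odd p ->
  (polylogp d).[x] = (-1) ^+ d * x ^+ p * (polylogp d).[y].
Proof.
move=> dp xy podd; rewrite !horner_polylogp.
have e z : \sum_(k < p) k%:R ^+ (p.-1 - d) * z ^+ k =
  \sum_(1 <= k < p) k%:R ^+ (p.-1 - d) * z ^+ k :> K.
  rewrite -(big_mkord xpredT (fun k => k%:R ^+ (p.-1 - d) * z ^+ k)).
  rewrite big_ltn ?prime_gt0 // expr0n (_ : (p.-1 - d == 0)%N = false) ?mul0r ?add0r //; lia.
rewrite !e big_nat_rev mulr_sumr; apply: eq_big_nat => k /andP[k0 kp].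
rewrite add1n subSS natr_sub_pchar ?(ltnW kp) // -mulN1r exprMn.
rewrite -[in x ^+ p](subnK (ltnW kp)) exprD.
have -> : (-1) ^+ (p.-1 - d) = (-1) ^+ d :> K.
  by rewrite -signr_odd -[RHS]signr_odd; congr (_ ^+ _); congr (nat_of_bool _); lia.
have xyk : x ^+ k * y ^+ k = 1 by rewrite -exprMn xy expr1n.
transitivity ((-1) ^+ d * k%:R ^+ (p.-1 - d) * x ^+ (p - k) * (x ^+ k * y ^+ k)).
  by rewrite xyk mulr1.
by ring.
Qed.

(* Telescoping (k + 1)^(j+1) - k^(j+1) expresses the j-th power sum through the
   lower ones. *)
Lemma sum_expr_natr_pchar j : (j < p.-1)%N -> \sum_(k < p) k%:R ^+ j = 0 :> K.
Proof.
elim/ltn_ind: j => j IHj jp.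
have tel : \sum_(k < p) (k.+1%:R ^+ j.+1 - k%:R ^+ j.+1) = 0 :> K.
  rewrite -(big_mkord xpredT (fun k => k.+1%:R ^+ j.+1 - k%:R ^+ j.+1)).
  by rewrite telescope_sumr // (pcharf0 pcharK) subrr.
apply: (@mulrn_coprime_eq0 j.+1); first by apply: coprime_lt_prime; lia.
rewrite -{}[RHS]tel -sumrMnl.
transitivity (\sum_(k < p) \sum_(i < j.+1) (k%:R ^+ i *+ 'C(j.+1, i)) : K).
  rewrite exchange_big big_ord_recr /= [X in _ = X + _]big1 ?add0r => [|i _].
    by apply: eq_bigr => k _; rewrite binSn.
  by rewrite sumrMnl IHj ?mul0rn // (ltn_trans _ jp).
apply: eq_bigr => k _; rewrite -natr1 exprD1n [in RHS]big_ord_recr /=.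
by rewrite binn mulr1n addrK.
Qed.

Lemma horner_polylogp_at1 d : (0 < d < p)%N -> (polylogp d).[1] = 0.
Proof.
case/andP=> d0 dp; rewrite horner_polylogp.
under eq_bigr => k _ do rewrite expr1n mulr1.
by apply: sum_expr_natr_pchar; lia.
Qed.

Let pchar_polyK : p \in [pchar {poly K}].
Proof. by rewrite pchar_poly. Qed.

(** Derivatives below are controlled only after multiplication by [X] or [1 - X]. Both are monic up
    to sign, hence regular over any ring. *)
Lemma mulX1X_eq0 (f : {poly K}) : 'X * (1 - 'X) * f = 0 -> f = 0.
Proof.
have -> : 'X * (1 - 'X) * f = - ('X * (('X - 1%:P) * f)) :> {poly K}.
  by rewrite polyC1; ring.
move/eqP; rewrite oppr_eq0 => /eqP e.
have /(monic_lreg (monicXsubC 1)) // : ('X - 1%:P) * f = ('X - 1%:P) * 0.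
by rewrite mulr0; apply: (monic_lreg (monicX K)); rewrite mulr0.
Qed.

Lemma size_comp_poly_1subX (f : {poly K}) : (size (f \Po (1 - 'X))%R <= maxn 1 (size f))%N.
Proof.
apply: leq_trans (size_comp_poly_leq _ _) _.
have : (size (1 - 'X : {poly K})%R <= 2)%N.
  by rewrite -opprB size_polyN -polyC1 size_XsubC.
by case: (size (1 - 'X)%R) (size f) => [|[|[|s]]] [|t] //= _; rewrite ?muln0 ?muln1; lia.
Qed.

Hypothesis p_gt3 : (3 < p)%N.

Let p_odd : odd p. Proof. exact: prime_gt3_odd p_prime p_gt3. Qed.

(** By [(1 - X)^p = 1 - X^p], the difference of the two sides has derivative zero. Its degree is
    below [p], so it is constant, and it vanishes at 0. *)
Lemma polylogp1_reflection : polylogp 1 \Po (1 - 'X) = polylogp 1.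
Proof.
apply/eqP; rewrite -subr_eq0; set f := _ - _.
have f'0 : f^`() = 0.
  apply: mulX1X_eq0.
  have e := mul_deriv_polylogp1.
  have := congr1 (fun g => g \Po (1 - 'X)) e.
  rewrite comp_polyM !comp_polyB comp_Xn_poly comp_polyX -polyC1 !comp_polyC polyC1 subKr => e'.
  rewrite derivB deriv_comp derivB derivX -polyC1 derivC polyC1 sub0r.
  transitivity (- (1 - 'X) * ('X * ((polylogp 1)^`() \Po (1 - 'X)))
    - 'X * ((1 - 'X) * (polylogp 1)^`())); first by ring.
  rewrite e e' -['X * _]/('X * (1 - 'X ^+ p.-1)).
  transitivity ((1 - 'X) * (1 - 'X) ^+ p.-1 - 1 + 'X * 'X ^+ p.-1 : {poly K}); first by ring.
  rewrite -!exprS prednK ?prime_gt0 // (exprD_pchar _ _ _ _ pchar_polyK).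
  by rewrite exprNn -signr_odd p_odd expr1n; ring.
rewrite (deriv_eq0_size_le_pchar _ f'0).
  rewrite /f !hornerE horner_comp !hornerE subr0 horner_polylogp_at1 ?horner_polylogp0 ?subr0 //; lia.
rewrite (leq_trans (size_polyD _ _)) // geq_max size_polyN size_polylogp andbT.
rewrite (leq_trans (size_comp_poly_1subX _)) // geq_max size_polylogp andbT.
exact: prime_gt0.
Qed.

(** With [L] and [G] for [d = 1] and [d = 2], use [X (1 - X) L' = X - X^p], [X G' = L] and
    [(1 - X) G'(1 - X) = L]: the difference of the sides has derivative zero. It has degree below
    [2p] and vanishes at 0 and 1. *)
Lemma sqr_polylogp1 :
  polylogp 1 ^+ 2 = - ((polylogp 2 * 'X^p + (polylogp 2 \Po (1 - 'X)) * (1 - 'X^p)) *+ 2).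
Proof.
apply/eqP; rewrite -subr_eq0 opprK; set f := _ + _; apply/eqP.
have Xp' : ('X^p)^`() = 0 :> {poly K} by rewrite derivXn -mulr_natr (pcharf0 pchar_polyK) mulr0.
have szG : (size (polylogp 2 \Po (1 - 'X))%R <= p)%N.
  rewrite (leq_trans (size_comp_poly_1subX _)) // geq_max size_polylogp andbT.
  exact: prime_gt0.
have szM (g h : {poly K}) : (size g <= p)%N -> (size h <= p.+1)%N -> (size (g * h)%R <= p.*2)%N.
  move=> sg sh; apply: leq_trans (size_polyMleq _ _) _; lia.
apply: deriv_eq0_size_le_double_pchar.
- apply: mulX1X_eq0.
  have e := mul_deriv_polylogp1.
  have e2 := mulX_deriv_polylogp2 p_gt3.
  have := congr1 (fun g => g \Po (1 - 'X)) e2.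
  rewrite comp_polyM comp_polyX polylogp1_reflection => e3.
  rewrite /f derivD derivMn derivD !derivM deriv_comp !derivB Xp' derivX -polyC1 derivC polyC1.
  have eX : 'X^p = 'X * 'X^(p.-1) :> {poly K} by rewrite -exprS prednK ?prime_gt0.
  transitivity (polylogp 1 * ('X * ((1 - 'X) * (polylogp 1)^`()) *+ 2)
     + ('X * (polylogp 2)^`()) * (1 - 'X) * 'X^p *+ 2
     - ((1 - 'X) * ((polylogp 2)^`() \Po (1 - 'X))) * 'X * (1 - 'X^p) *+ 2).
    by ring.
  by rewrite e e2 e3 eX; ring.
- rewrite (leq_trans (size_polyD _ _)) // geq_max expr2 szM ?size_polylogp //=; last first.
    by rewrite (leq_trans (size_polylogp _)).
  rewrite -mulr_natr -polyC_natr mulrC mul_polyC (leq_trans (size_scale_leq _ _)) //.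
  rewrite (leq_trans (size_polyD _ _)) // geq_max !szM ?size_polylogp ?size_polyXn //.
  by rewrite -opprB size_polyN -polyC1 size_XnsubC // prime_gt0.
- rewrite /f !hornerE !horner_comp !hornerE subr0 !horner_polylogp_at1 ?horner_polylogp0 //; try lia.
  by rewrite /=; ring.
- rewrite /f !hornerE ?horner_comp ?hornerE subrr !horner_polylogp_at1 ?horner_polylogp0 //; try lia.
  by rewrite /=; ring.
Qed.

End CharP.

(** * Euler polynomials *)

(** For odd [n] the recurrence involves only odd indices, so induction applies. *)
Lemma euler_odd n : odd n -> euler n = 0.
Proof.
elim/ltn_ind: n => n IHn n_odd; have := euler_sum n.
rewrite big_mkcond big_ord_recr /= subnn binn mul1r /= big1 ?add0r => [->|k _].
  by case: n n_odd {IHn}.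
by case: ifP => // nk; rewrite IHn ?mulr0 //; have := ltn_ord k; lia.
Qed.

Section EulerUmbra.
Variables (K : comNzRingType) (N : nat).

(** The umbral functional [X^k -> E_k]. The fixed bound [N], instead of the size of [f], makes
    linearity immediate. *)
Definition euler_umbra (f : {poly K}) : K := \sum_(k < N) f`_k * (euler k)%:~R.

Fact euler_umbra_is_linear : linear_for *%R euler_umbra.
Proof.
move=> c f g; rewrite /euler_umbra mulr_sumr -big_split; apply: eq_bigr => k _.
by rewrite coefD coefZ mulrDl mulrA.
Qed.

HB.instance Definition _ :=
  GRing.isLinear.Build K {poly K} K *%R euler_umbra euler_umbra_is_linear.

Lemma euler_umbra_XaddC (c : K) l : (l < N)%N ->
  euler_umbra (('X + c%:P) ^+ l) =
    \sum_(k < l.+1) 'C(l, k)%:R * c ^+ (l - k) * (euler k)%:~R.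
Proof.
move=> lN; rewrite addrC exprDn raddf_sum; apply: eq_bigr => k _ /=.
rewrite -polyC_exp mul_polyC -scaler_nat scalerA linearZ /=; congr (_ * _).
rewrite /euler_umbra (bigD1 (Ordinal (leq_trans (ltn_ord k) lN))) //= coefXn eqxx mul1r.
rewrite big1 ?addr0 // => j; rewrite -val_eqE /= coefXn => /negbTE->.
by rewrite mul0r.
Qed.

(** On [X^l] the two shifts cancel in the terms with [l - k] odd and double the others, which leaves
    twice the recurrence of the Euler numbers. *)
Lemma euler_umbra_shift (f : {poly K}) : (size f <= N)%N ->
  euler_umbra (f \Po ('X + 1%:P)) + euler_umbra (f \Po ('X + (-1)%:P)) = f`_0 *+ 2.
Proof.
move=> szf; rewrite !comp_polyE !raddf_sum -big_split /=.
transitivity (\sum_(l < size f) f`_l * ((l == 0%N :> nat)%:R *+ 2)).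
  apply: eq_bigr => l _; rewrite !linearZ -mulrDr; congr (_ * _).
  rewrite /= !euler_umbra_XaddC ?(leq_trans (ltn_ord l)) // -big_split /=.
  have /(congr1 (fun z => z%:~R *+ 2 : K)) := euler_sum l.
  rewrite /= -[((_ == _) : nat)%:Z%:~R]/((l == 0%N :> nat)%:R : K) => <-.
  rewrite raddf_sum -sumrMnl [RHS]big_mkcond; apply: eq_bigr => k _ /=.
  rewrite expr1n -(signr_odd K (l - k)) rmorphM /=.
  by case: (odd _); rewrite /= ?expr1 ?expr0 -?pmulrn; ring.
(* For [f = 0] the sum is empty and the constant coefficient is the default 0. *)
case: (size f) (@nth_default _ 0 f 0%N) => [-> //|s _]; first by rewrite big_ord0 mul0rn.
by rewrite big_ord_recl /= big1 ?addr0 => [|i _]; rewrite ?mulr0n ?mul0rn ?mulr0 // mulrnAr mulr1.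
Qed.

End EulerUmbra.

(* [euler_shift K n x] is 2 ^ n times the n-th Euler polynomial at (x + 1) / 2. *)
Definition euler_shift (K : comNzRingType) (n : nat) (x : K) : K :=
  euler_umbra K n.+1 (('X + x%:P) ^+ n).

Section EulerShift.
Variable K : comNzRingType.

(** With [y = x / 2] this is the functional equation [E_n(y + 1) + E_n(y) = 2 y^n] of the Euler
    polynomials, cleared of denominators. *)
Lemma euler_shiftD1 n (x : K) :
  euler_shift K n (x + 1) + euler_shift K n (x - 1) = x ^+ n *+ 2.
Proof.
have := euler_umbra_shift K n.+1 (('X + x%:P) ^+ n).
rewrite -{1}[x]opprK polyCN size_exp_XsubC -horner_coef0 !hornerE => /(_ (leqnn _)) <-.
have comp_XaddC (c : K) : ('X + x%:P) ^+ n \Po ('X + c%:P) = ('X + (x + c)%:P) ^+ n.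
  by rewrite rmorphXn /= comp_polyD comp_polyX comp_polyC -addrA -polyCD [c + x]addrC.
by rewrite !comp_XaddC.
Qed.

Lemma euler_shift0 n : euler_shift K n 0 = (euler n)%:~R :> K.
Proof.
rewrite /euler_shift euler_umbra_XaddC // big_ord_recr /= subnn binn !mul1r.
rewrite big1 ?add0r // => k _; rewrite expr0n.
by rewrite subn_eq0 leqNgt ltn_ord mulr0 mul0r.
Qed.

(** For even [n] the terms of odd index vanish by [euler_odd], and the rest is the recurrence. *)
Lemma euler_shift1 n : ~~ odd n -> (0 < n)%N -> euler_shift K n 1 = 0 :> K.
Proof.
move=> n_even n_gt0; rewrite /euler_shift euler_umbra_XaddC //.
have /(congr1 (fun z => z%:~R : K)) e := euler_sum n.
transitivity ((n == 0%N)%:Z%:~R : K); last by rewrite gtn_eqF.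
rewrite -e raddf_sum [RHS]big_mkcond /=.
apply: eq_bigr => k _; rewrite expr1n mulr1; case: ifPn => [_|]; first by rewrite rmorphM.
by rewrite negbK => nk; rewrite euler_odd ?mulr0 //; have := ltn_ord k; lia.
Qed.

(** The alternating sum of the functional equations at [2, 4, ..., 2m] telescopes, starting from the
    zero at 1. *)
Lemma euler_shift_odd n m : ~~ odd n -> (0 < n)%N ->
  (-1) ^+ m * euler_shift K n m.*2.+1%:R =
    (\sum_(1 <= j < m.+1) (-1) ^+ j * j.*2%:R ^+ n) *+ 2.
Proof.
move=> n_even n_gt0; elim: m => [|m IHm].
  by rewrite big_geq // euler_shift1 // mulr0 mul0rn.
rewrite big_nat_recr //= mulrnDl -{}IHm -mulrnAr.
have := euler_shiftD1 n m.+1.*2%:R.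
rewrite (_ : m.+1.*2%:R - 1 = m.*2.+1%:R) ?natr1 => [<-|]; last first.
  by rewrite doubleS -[LHS]/(m.*2.+2%:R - 1) -natr1 addrK.
by rewrite exprS; ring.
Qed.

End EulerShift.

Lemma sum_double_even (V : nmodType) (F : nat -> V) m :
  (forall k, odd k -> F k = 0) ->
  \sum_(0 <= k < m.*2.+1) F k = \sum_(0 <= j < m.+1) F j.*2.
Proof.
move=> F0; elim: m => [|m IHm]; first by rewrite !big_nat1.
rewrite doubleS [RHS]big_nat_recr //= -IHm !big_nat_recr //= [F m.*2.+1]F0 ?addr0 //.
by rewrite /= odd_double.
Qed.

(** * Values at square roots of -1 *)

Section GaussianPoints.
Variables (K : comNzRingType) (p : nat).
Hypotheses (pcharK : p \in [pchar K]) (p_gt3 : (3 < p)%N).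

Let p_prime : prime p. Proof. exact: pcharf_prime pcharK. Qed.
Let p_odd : odd p. Proof. exact: prime_gt3_odd p_prime p_gt3. Qed.
Let p_eq : p = p./2.*2.+1. Proof. exact: odd_half_doubleS. Qed.

Let c : K := (-1) ^+ p./2.
Let E : K := (euler (p - 3))%:~R.
Let G x : K := (polylogp K p 2).[x].
Let L x : K := (polylogp K p 1).[x].

Let cc : c * c = 1.
Proof. by rewrite -expr2 -exprM mulnC exprM sqrrN !expr1n. Qed.

Lemma sqrN1_expr_pchar (J : K) : J ^+ 2 = -1 -> J ^+ p = c * J.
Proof. by move=> J2; rewrite {1}p_eq exprSr -mul2n exprM J2. Qed.

Lemma polylogp2_sqrtN1_sum (J : K) : J ^+ 2 = -1 -> G J + G (- J) = c * E.
Proof.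
(* In [K] the point 0 is also [p], the end of the telescoped range. The odd powers of [J] and [- J]
   cancel, and the even ones give the same alternating sum. *)
move=> J2; rewrite /E -euler_shift0 (_ : 0 = p./2.*2.+1%:R); last first.
  by rewrite -p_eq (pcharf0 pcharK).
rewrite euler_shift_odd; try lia.
rewrite /G !horner_polylogp -big_split /=.
pose F k : K := k%:R ^+ (p.-1 - 2) * J ^+ k + k%:R ^+ (p.-1 - 2) * (- J) ^+ k.
rewrite -(big_mkord xpredT F) {1}p_eq sum_double_even => [|k k_odd]; last first.
  by rewrite /F exprNn -signr_odd k_odd; ring.
rewrite [LHS]big_ltn // {1}/F expr0n (_ : (p.-1 - 2 == 0)%N = false) ?mul0r ?add0r; last by lia.
rewrite -sumrMnl; apply: eq_big_nat => j _; rewrite /F.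
rewrite -!mul2n !exprM sqrrN J2.
have -> : (p.-1 - 2 = p - 3)%N by lia.
by ring.
Qed.

(** [Q] stands for the Fermat quotient of 2 in [K]. Granville's identity is taken at [1 + J], whose
    [p]-th power is [1 + c * J]. *)
Lemma polylogp2_1addJ (J Q : K) : J ^+ 2 = -1 ->
  L (- J) *+ 2 = - ((1 + c * J) * Q) ->
  G (1 + J) *+ 8 = c * E *+ 4 - (1 + c * J) * Q ^+ 2.
Proof.
move=> J2 LQ; have ww : (c * J) ^+ 2 = -1 by rewrite exprMn J2 expr2 cc mul1r.
have GJ : G J = c * J * G (- J).
  rewrite /G (polylogp_inversion _ _ pcharK 2 J (- J)) //; try lia.
    by rewrite sqrrN expr1n mul1r sqrN1_expr_pchar.
  by rewrite mulrN -expr2 J2 opprK.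
have GE := polylogp2_sqrtN1_sum _ J2; rewrite GJ in GE.
have uJ : (1 + J) ^+ p = 1 + c * J.
  by rewrite (exprD_pchar _ _ _ _ pcharK) expr1n sqrN1_expr_pchar.
have LJ : L (1 + J) = L (- J).
  have /(congr1 (fun f => f.[1 + J])) := polylogp1_reflection _ _ pcharK p_gt3.
  by rewrite horner_comp !hornerE opprD addNKr => /esym.
have L2 : L (- J) ^+ 2 =
    - ((G (1 + J) * (1 + c * J) + G (- J) * (1 - (1 + c * J))) *+ 2).
  have := congr1 (fun f => f.[1 + J]) (sqr_polylogp1 _ _ pcharK p_gt3).
  rewrite horner_exp hornerN hornerMn hornerD !hornerM hornerD hornerN horner_comp.
  rewrite hornerD hornerN hornerX !hornerXn -polyC1 !hornerC uJ.
  by rewrite (_ : 1 - (1 + J) = - J) -/(L _) ?LJ //; ring.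
(* With [w = c * J], the coefficient [1 + w] of [G (1 + J)] is removed by [(1 - w) * (1 + w) = 2],
   whence the extra factor 2. *)
have eq0 : (G (1 + J) *+ 8 - (c * E *+ 4 - (1 + c * J) * Q ^+ 2)) *+ 2 = 0.
  have LQ2 : (L (- J) *+ 2) ^+ 2 = (1 + c * J) ^+ 2 * Q ^+ 2 by rewrite LQ; ring.
  move/eqP: L2; rewrite -subr_eq0 => /eqP D1.
  move/eqP: LQ2; rewrite -subr_eq0 => /eqP D2.
  move/eqP: GE; rewrite -subr_eq0 => /eqP D3.
  move/eqP: ww; rewrite -subr_eq0 => /eqP D4.
  set g := G (1 + J) in D1 *; set b := G (- J) in D1 D3 *; set l := L (- J) in D1 D2.
  set w := c * J in D1 D2 D3 D4 *.
  (* Each parenthesis is one of the vanishing differences D1, D2, D3, D4. *)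
  transitivity ((1 - w) * ((l ^+ 2 - - ((g * (1 + w) + b * (1 - (1 + w))) *+ 2)) *+ 4
      - ((l *+ 2) ^+ 2 - (1 + w) ^+ 2 * Q ^+ 2)) + (w * b + b - c * E) *+ 8
    + (w ^+ 2 - -1) * (g *+ 8 + (1 + w) * Q ^+ 2 - b *+ 8)); first by ring.
  by rewrite D1 D2 D3 D4; ring.
apply/eqP; rewrite -subr_eq0; apply/eqP.
apply: (mulrn_coprime_eq0 _ _ pcharK 2 _ _ eq0).
by rewrite coprime2n.
Qed.

(** Here [y] is the inverse of [1 - J], so inversion reduces to [polylogp2_1addJ] at [- J]. *)
Lemma polylogp2_half_1addJ (J Q y : K) : J ^+ 2 = -1 ->
  L J *+ 2 = - ((1 - c * J) * Q) -> y *+ 2 = 1 + J ->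
  G y *+ 8 = (c + J) * E *+ 2 - Q ^+ 2.
Proof.
move=> J2 LQ y2; have mJ2 : (- J) ^+ 2 = -1 by rewrite sqrrN.
have ww : (c * J) ^+ 2 = -1 by rewrite exprMn J2 expr2 cc mul1r.
have yJ : y * (1 - J) = 1.
  apply/eqP; rewrite -subr_eq0; apply/eqP.
  apply: (mulrn_coprime_eq0 _ _ pcharK 2); first by rewrite coprime2n.
  rewrite mulrnBl -mulrnAl y2.
  by transitivity (- (J ^+ 2 + 1)); [ring | rewrite J2 addNr oppr0].
(* Since [2 ^ p = 2] in [K], the left side is [(y *+ 2) ^+ p]. *)
have yp : y ^+ p *+ 2 = 1 + c * J.
  rewrite -mulr_natr -(natr_pchar_eqmod _ _ pcharK (2 ^ p) 2) ?fermat_little //.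
  rewrite natrX -exprMn mulr_natr y2.
  by rewrite (exprD_pchar _ _ _ _ pcharK) expr1n sqrN1_expr_pchar.
have := polylogp2_1addJ (- J) Q mJ2; rewrite opprK mulrN LQ => /(_ erefl) GJ.
have Gy : G y = y ^+ p * G (1 - J).
  by rewrite /G (polylogp_inversion _ _ pcharK 2 y (1 - J)) ?sqrrN ?expr1n ?mul1r //; lia.
apply/eqP; rewrite -subr_eq0; apply/eqP.
apply: (mulrn_coprime_eq0 _ _ pcharK 2); first by rewrite coprime2n.
rewrite Gy.
transitivity ((y ^+ p *+ 2) * (G (1 - J) *+ 8) - ((c + J) * E *+ 4 - Q ^+ 2 *+ 2)); first by ring.
rewrite yp GJ.
transitivity ((c * c - 1) * J * E *+ 4 + ((c * J) ^+ 2 + 1) * Q ^+ 2); first by ring.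
by rewrite cc ww; ring.
Qed.

End GaussianPoints.

(** * The Legendre symbol of -1 *)

Lemma legendreN1 p : prime p -> odd p -> legendre (-1) p = (-1) ^+ p./2.
Proof.
move=> p_prime p_odd; rewrite /legendre.
have p_eq := odd_half_doubleS _ p_odd.
have p_gt2 : (2 < p)%N by case: p p_prime p_odd {p_eq} => [|[|[|]]].
have N1 : (-1)%:~R = -1 :> 'F_p by rewrite rmorphN1.
rewrite N1 oppr_eq0 oner_eq0.
have xp1 (x : 'F_p) : x != 0 -> x ^+ p./2 ^+ 2 = 1.
  move=> x0; apply: (mulIf x0); rewrite -exprM muln2 -exprSr -p_eq mul1r.
  by have := expf_card x; rewrite card_Fp.
have neq1 : -1 != 1 :> 'F_p.
  rewrite -subr_eq0 -opprD oppr_eq0 -(natrD _ 1 1) -(dvdn_pcharf (pchar_Fp p_prime)).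
  by rewrite gtnNdvd.
rewrite -signr_odd; case: existsP => [[x /eqP x2]|noroot].
  have x0 : x != 0.
    by apply/eqP=> x0; move/eqP: x2; rewrite x0 expr0n eq_sym oppr_eq0 oner_eq0.
  have := xp1 x x0; rewrite exprAC x2 -[LHS](signr_odd 'F_p).
  by case: (odd _) => // e; case/eqP: neq1.
case: (boolP (odd p./2)) => [//|m_even]; case: noroot.
have m_eq : (p./2 = p./2./2.*2)%N by rewrite -{1}[p./2]odd_double_half (negbTE m_even).
(* As [p./2] is even, such an [x] yields a square root of -1. Without one, all [p - 1] nonzero
   elements would be roots of a polynomial of degree [p./2]. *)
suff /existsP[x /eqP xN1] : [exists x : 'F_p, x ^+ p./2 == -1].
  by exists (x ^+ p./2./2); rewrite -exprM muln2 -m_eq xN1.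
apply: contraT; rewrite negb_exists => /forallP no_N1.
have : (size (enum (predC1 (0%R : 'F_p))) < size ('X^(p./2) - 1%:P : {poly 'F_p})%R)%N.
  apply: max_poly_roots.
  - by rewrite -size_poly_eq0 size_XnsubC //; lia.
  - apply/allP=> x; rewrite mem_enum inE => x0.
    rewrite /root !hornerE; have /eqP := xp1 x x0.
    by rewrite sqrf_eq1 (negbTE (no_N1 x)) orbF subr_eq0.
  - exact: enum_uniq.
by rewrite -cardE cardC1 card_Fp // size_XnsubC; lia.
Qed.

(** * Reduction of Gaussian numbers modulo p *)

HB.instance Definition _ := GRing.RMorphism.copy gauss_int_val (val : gauss_int -> algC).

(* The divisor is n + 2, so that the ideal is proper for every n. *)
Definition gauss_int_dvd (n : nat) : {pred gauss_int} :=
  fun x => (x : algC) / n.+2%:R \in gauss_int_pred.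

Fact gauss_int_dvd_idealr n : idealr_closed (gauss_int_dvd n).
Proof.
split=> [||a x y xI yI]; rewrite unfold_in.
- by rewrite /= mul0r rpred0.
(* The ideal is proper: [1 / (n + 2)] is nonzero of absolute value below 1, hence not an integer. *)
- rewrite /= mul1r; apply/negP=> /andP[].
  have -> : 'Re (n.+2%:R^-1 : algC) = n.+2%:R^-1 by apply/Creal_ReP; rewrite rpredV realn.
  move=> nV _; have := norm_intr_ge1 nV.
  rewrite invr_eq0 pnatr_eq0 => /(_ isT).
  by rewrite ger0_norm ?invr_ge0 ?ler0n // invf_ge1 ?ltr0n // (ler_nat _ _ 1).
- rewrite [val _]/(val a * val x + val y) mulrDl -mulrA rpredD // rpredM //; exact: valP.
Qed.

HB.instance Definition _ n :=
  isIdealr.Build gauss_int (gauss_int_dvd n) (gauss_int_dvd_idealr n).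

(** The quotient is by [p] itself, not by a prime above it: congruence modulo [p] is then equality
    in [K], at the price of zero divisors when [p] splits. *)
Lemma gauss_int_mod_prime p : prime p ->
  exists (K : comNzRingType) (f : {rmorphism gauss_int -> K}),
    p \in [pchar K] /\ forall x, f x = 0 -> exists y : gauss_int, x = y *+ p.
Proof.
case: p => [|[|n]] // p_prime.
pose K : comNzRingType := {ideal_quot (gauss_int_dvd n)}.
pose f : {rmorphism gauss_int -> K} := \pi_K%qT.
have f0 x : f x = 0 <-> x \in gauss_int_dvd n.
  by rewrite -[x in x \in _]subr0 Quotient.idealrBE -(rmorph0 f); split=> /eqP.
exists K, f; split=> [|x /f0 xI].
  rewrite inE p_prime -(rmorph_nat f); apply/eqP/f0.
  by rewrite unfold_in (rmorph_nat gauss_int_val) divff ?pnatr_eq0 // rpred1.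
exists (GaussInt xI); apply: val_inj.
by rewrite raddfMn /= -[RHS]mulr_natr divfK // pnatr_eq0.
Qed.

(** * The binomial expansion of [(1 + x)^p] modulo [p^2] *)

Section FreshmanQuotient.
Variables (K : comNzRingType) (p : nat) (pcharK : p \in [pchar K]).
Let p_prime : prime p. Proof. exact: pcharf_prime pcharK. Qed.

(** By Pascal's rule consecutive values add up to ['C(p, k.+1)], which is 0 in [K]. *)
Lemma bin_pred_pchar k : (k < p)%N -> 'C(p.-1, k)%:R = (-1) ^+ k :> K.
Proof.
elim: k => [|k IHk] kp; first by rewrite bin0.
have := @bin_lt_pcharf_0 K p pcharK k.+1 kp.
rewrite -{1}(prednK (prime_gt0 p_prime)) binS natrD IHk; last exact: ltnW.
by rewrite exprS mulN1r => /eqP; rewrite addr_eq0 => /eqP.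
Qed.

(** Multiplied by [k], the left side becomes ['C(p.-1, k.-1)], known from [bin_pred_pchar]. *)
Lemma bin_div_pchar k : (0 < k < p)%N ->
  ('C(p, k) %/ p)%:R = - ((-1) ^+ k * k%:R ^+ (p.-1 - 1)) :> K.
Proof.
move=> /[dup] k0p /andP[k0 kp].
have pC : (p %| 'C(p, k))%N by rewrite prime_dvd_bin.
have kC : (k * ('C(p, k) %/ p) = 'C(p.-1, k.-1))%N.
  apply/eqP; rewrite -(eqn_pmul2l (prime_gt0 p_prime)) mulnCA [(p * (_ %/ _))%N]mulnC divnK //.
  by rewrite mul_bin_diag prednK.
apply/eqP; rewrite -subr_eq0; apply/eqP.
apply: (mulrn_coprime_eq0 _ _ pcharK k); first exact: coprime_lt_prime.
rewrite -[LHS]mulr_natl mulrBr -natrM kC bin_pred_pchar; last by lia.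
rewrite mulrN opprK mulrCA -exprS (_ : (p.-1 - 1).+1 = p.-1); last by lia.
rewrite expr_pred_pchar_natr ?coprime_lt_prime // mulr1 -{2}(prednK k0) exprS.
by rewrite mulN1r subrr.
Qed.

Lemma exprD1_freshman (R : comNzRingType) (f : {rmorphism R -> K}) (x : R) :
  (2 < p)%N -> exists2 M : R, (1 + x) ^+ p = 1 + x ^+ p + M *+ p &
    f M = - (polylogp K p 1).[- f x].
Proof.
move=> p_gt2; exists (\sum_(1 <= k < p) x ^+ k *+ ('C(p, k) %/ p)).
  rewrite addrC exprD1n -(big_mkord xpredT (fun i => x ^+ i *+ 'C(p, i))).
  rewrite big_nat_recr //= big_ltn ?prime_gt0 // bin0 binn expr0 !mulr1n.
  rewrite addrAC; congr (_ + _).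
  rewrite -sumrMnl; apply: eq_big_nat => k k0p.
  by rewrite -mulrnA divnK // prime_dvd_bin.
rewrite horner_polylogp.
rewrite -(big_mkord xpredT (fun k => k%:R ^+ (p.-1 - 1) * (- f x) ^+ k)).
rewrite big_ltn ?prime_gt0 // expr0n (_ : (p.-1 - 1 == 0)%N = false) ?mul0r ?add0r; last by lia.
rewrite rmorph_sum -sumrN; apply: eq_big_nat => k k0p.
by rewrite rmorphMn rmorphXn -[LHS]mulr_natr bin_div_pchar // (exprNn (f x)); ring.
Qed.

End FreshmanQuotient.

(** * Reduction of [p]-integral Gaussian numbers *)

Section Reduction.
Variables (K : comNzRingType) (p : nat) (pcharK : p \in [pchar K]).
Variable f : {rmorphism gauss_int -> K}.
Hypothesis ker_f : forall x, f x = 0 -> exists y : gauss_int, x = y *+ p.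
Let p_prime : prime p. Proof. exact: pcharf_prime pcharK. Qed.

(* [z] is integral at [p] with image [w] under the extension of [f]. *)
Definition reduces (z : algC) (w : K) : Prop :=
  exists (m : nat) (a : gauss_int), [/\ coprime m p, m%:R * z = a & f a = m%:R * w].

Lemma reduces_gauss (a : gauss_int) : reduces a (f a).
Proof. by exists 1%N, a; rewrite !mul1r coprime1n. Qed.

Lemma reduces1 : reduces 1 1.
Proof. by have := reduces_gauss 1; rewrite !rmorph1. Qed.

Lemma reduces_nat n : reduces n%:R n%:R.
Proof. by have := reduces_gauss n%:R; rewrite !rmorph_nat. Qed.

Lemma reduces_int (n : int) : reduces n%:~R n%:~R.
Proof. by have := reduces_gauss n%:~R; rewrite !rmorph_int. Qed.

Lemma reducesD z w z' w' : reduces z w -> reduces z' w' -> reduces (z + z') (w + w').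
Proof.
move=> [m [a [mp za wa]]] [m' [a' [mp' za' wa']]].
exists (m * m')%N, (a *+ m' + a' *+ m); split; first by rewrite coprimeMl mp.
  by rewrite rmorphD !rmorphMn /= -za -za' ?natrM; ring.
by rewrite rmorphD !rmorphMn /= wa wa' ?natrM; ring.
Qed.

Lemma reducesM z w z' w' : reduces z w -> reduces z' w' -> reduces (z * z') (w * w').
Proof.
move=> [m [a [mp za wa]]] [m' [a' [mp' za' wa']]].
exists (m * m')%N, (a * a'); split; first by rewrite coprimeMl mp.
  by rewrite rmorphM /= -za -za' ?natrM; ring.
by rewrite rmorphM /= wa wa' ?natrM; ring.
Qed.

Lemma reducesN z w : reduces z w -> reduces (- z) (- w).
Proof.
move=> [m [a [mp za wa]]]; exists m, (- a).
by rewrite !rmorphN /= -za wa !mulrN.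
Qed.

Lemma reducesX n z w : reduces z w -> reduces (z ^+ n) (w ^+ n).
Proof.
by move=> zw; elim: n => [|n IHn]; rewrite ?expr0 ?exprS; [exact: reduces1|exact: reducesM].
Qed.

Lemma coprime_gt0 m : coprime m p -> (0 < m)%N.
Proof. by case: m => //; rewrite /coprime gcd0n => /eqP p1; move: p_prime; rewrite p1. Qed.

Lemma reduces_natV (m : nat) v : coprime m p -> m%:R * v = 1 -> reduces m%:R^-1 v.
Proof.
move=> mp mv; exists m, 1; rewrite !rmorph1 mv divff //.
by rewrite pnatr_eq0 -lt0n coprime_gt0.
Qed.

Lemma reduces_polylog d x w : (d.+1 < p)%N -> reduces x w ->
  reduces (finite_polylog p d x) (polylogp K p d).[w].
Proof.
move=> dp xw; rewrite horner_polylogp.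
rewrite -(big_mkord xpredT (fun k => k%:R ^+ (p.-1 - d) * w ^+ k)).
rewrite big_ltn ?prime_gt0 // expr0n (_ : (p.-1 - d == 0)%N = false) ?mul0r ?add0r; last by lia.
rewrite /finite_polylog [X in reduces X _]big_nat [X in reduces _ X]big_nat.
apply: (big_ind2 reduces) => [||k k0p]; [exact: (reduces_nat 0)|exact: reducesD|].
rewrite mulrC -natrX; apply: reducesM; last exact: reducesX.
apply: reduces_natV; first by rewrite coprimeXl // coprime_lt_prime.
rewrite natrX -exprD (_ : (d + (p.-1 - d) = p.-1)%N); last by lia.
by rewrite expr_pred_pchar_natr // coprime_lt_prime.
Qed.

(** The difference reduces to 0, so its numerator is divisible by [p] and the quotient is [b / m]
    with [m] prime to [p]. *)
Lemma reduces_eqmod z z' w : reduces z w -> reduces z' w -> eqmod_above p z z'.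
Proof.
move=> zw /reducesN z'w; have [m [a [mp za]]] := reducesD _ _ _ _ zw z'w.
rewrite subrr mulr0 => /ker_f[b a_eq].
have m0 : m%:R != 0 :> algC by rewrite pnatr_eq0 -lt0n coprime_gt0.
have p0 : p%:R != 0 :> algC by rewrite pnatr_eq0 -lt0n prime_gt0.
have zb : (z - z') / p%:R = (b : algC) / m%:R.
  apply: (mulfI m0); rewrite mulrA za a_eq rmorphMn /= -mulr_natr mulfK //.
  by rewrite mulrC divfK.
rewrite /eqmod_above zb; split=> [|P pP].
  have mV : (m%:R^-1 : algC) \is Num.real by rewrite rpredV realn.
  have mQ : (m%:R^-1 : algC) \in Crat by rewrite rpredV rpred_nat.
  have int_rat (x : algC) : x \is a Num.int -> x \in Crat.
    by case/intrP=> n ->; rewrite rpred_int.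
  have /andP[bR bI] := valP b.
  rewrite /gauss_rat unfold_in mulrC ReMl // ImMl //.
  by rewrite !rpredM // int_rat.
exists b, m%:R; rewrite rmorph_nat; split=> //; apply/negP=> mP.
(* Bezout gives [1 = v m - u p], so an ideal containing [p] and [m] would contain 1. *)
have [u _] := Bezoutl p (coprime_gt0 _ mp); rewrite (eqP mp) => /dvdnP[v e].
have := idealr1 P; rewrite -[1](addrK (u%:R * p%:R)) -natrM -(natrD _ 1) e natrM.
by rewrite rpredB ?natrM // idealMr.
Qed.

End Reduction.

Lemma imaginary_gauss_int (s : algC) : s = 1 \/ s = -1 -> s * 'i \in gauss_int_pred.
Proof.
have iP : 'i \in gauss_int_pred by rewrite unfold_in Re_i Im_i rpred0 rpred1.
by case=> ->; rewrite ?mul1r ?mulN1r ?rpredN.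
Qed.

Lemma gauss_int_mulrnI (x y : gauss_int) n : (0 < n)%N -> x *+ n = y *+ n -> x = y.
Proof.
move=> n0 /(congr1 gauss_int_val); rewrite !rmorphMn /= => /eqP.
by rewrite eqrMn2r gtn_eqF //= => /eqP/val_inj.
Qed.

Lemma fermat_quotient2_nat p : prime p -> (2 < p)%N ->
  exists q : nat, (2 ^ p.-1 = q * p + 1)%N.
Proof.
move=> p_prime p_gt2; have cop : coprime 2 p by rewrite coprime_lt_prime.
have := Euler_exp_totient cop; rewrite totient_prime // => e.
exists (2 ^ p.-1 %/ p)%N; rewrite {1}(divn_eq (2 ^ p.-1) p) e modn_small //; lia.
Qed.

(** * The first polylogarithm and the Fermat quotient of 2 *)

Section FermatQuotient.
Variables (K : comNzRingType) (p : nat) (pcharK : p \in [pchar K]).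
Variable f : {rmorphism gauss_int -> K}.
Hypothesis p_gt3 : (3 < p)%N.
Let p_prime : prime p. Proof. exact: pcharf_prime pcharK. Qed.
Let p_odd : odd p. Proof. exact: prime_gt3_odd p_prime p_gt3. Qed.
Let p_eq : p = p./2.*2.+1. Proof. exact: odd_half_doubleS. Qed.

Lemma polylogp1_fermat_quotient (J : gauss_int) (q : nat) : J ^+ 2 = -1 ->
  (2 ^ p.-1 = q * p + 1)%N ->
  (polylogp K p 1).[- f J] *+ 2 = - ((1 + (-1) ^+ p./2 * f J) * q%:R).
Proof.
move=> J2 qE; have [|M ME fM] := exprD1_freshman _ _ pcharK _ f J; first exact: ltnW.
pose c : gauss_int := (-1) ^+ p./2.
have cc : c ^+ 2 = 1 by rewrite -exprM mulnC exprM sqrrN !expr1n.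
have Jp : J ^+ p = c * J by rewrite {1}p_eq exprSr -mul2n exprM J2.
have ww : (c * J) ^+ 2 = -1 by rewrite exprMn cc J2 mul1r.
(* From [(1 + J)^2 = 2 J] and [2^p = 2 (q p + 1)]. *)
have sq : ((1 + J) ^+ p) ^+ 2 = c * J * (2%:R + (q * p)%:R *+ 2).
  rewrite exprAC (_ : (1 + J) ^+ 2 = 2%:R * J + (J ^+ 2 + 1)); last by ring.
  have e2p : (2 ^ p)%:R = 2%:R * (q * p + 1)%:R :> gauss_int.
    by rewrite -qE -natrM -expnS prednK ?prime_gt0.
  by rewrite J2 addNr addr0 exprMn Jp -natrX e2p natrD; ring.
(* Compare [sq] with the square of [1 + c * J + M *+ p] and divide by [p], which is legitimate
   before reduction. *)
have eqM : (1 + c * J) * M *+ 2 + M ^+ 2 *+ p = c * J * q%:R *+ 2.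
  apply: (gauss_int_mulrnI _ _ p (prime_gt0 p_prime)).
  apply/eqP; rewrite -subr_eq0; apply/eqP.
  transitivity ((1 + c * J + M *+ p) ^+ 2 - c * J * (2%:R + (q * p)%:R *+ 2)
     - ((c * J) ^+ 2 + 1)); first by rewrite natrM; ring.
  by rewrite ww -Jp -ME sq Jp; ring.
have fc : f c = (-1) ^+ p./2 by rewrite rmorphXn rmorphN1.
have fww : (f c * f J) ^+ 2 = -1 by rewrite -rmorphM -rmorphXn ww rmorphN1.
have {}eqM : (1 + f c * f J) * f M *+ 2 = f c * f J * q%:R *+ 2.
  rewrite -[LHS]addr0 -[X in _ + X](mulr0 (f M ^+ 2)) -(pcharf0 pcharK) [X in _ + X]mulr_natr.
  have := congr1 f eqM.
  by rewrite rmorphD !rmorphMn rmorphXn !rmorphM rmorphD rmorph1 rmorphM rmorph_nat.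
rewrite -fc; apply/eqP; rewrite -subr_eq0 opprK; apply/eqP.
apply: (mulrn_coprime_eq0 _ _ pcharK 2); first by rewrite coprime2n.
have -> : (polylogp K p 1).[- f J] = - f M by rewrite fM opprK.
move: eqM fww; set w := f c * f J; set Q : K := q%:R; set m := f M => eqM fww.
(* Again [1 + w] is cleared through [(1 + w) * (1 - w) = 2]. *)
transitivity ((w * Q *+ 2 - (1 + w) * m *+ 2) * (1 - w)
  + (w ^+ 2 + 1) * (Q *+ 2 - m *+ 2)); first by ring.
by rewrite eqM fww; ring.
Qed.

End FermatQuotient.

(** * The two congruences *)

Theorem theorem4p2 (p : nat) (p_prime : prime p) (p_gt3 : (3 < p)%N)
    (s : algC) (s_sign : s = 1 \/ s = -1) :
  let q : algC := fermat_quotient algC p 2 in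
  let chi : algC := (legendre (-1) p)%:~R in
  let E : algC := (euler (p - 3))%:~R in
  eqmod_above p (finite_polylog p 2 (1 + s * 'i))
    (- (q ^+ 2 / 8) * (1 + s * 'i * chi) + 1 / 2 * chi * E)
  /\
  eqmod_above p (finite_polylog p 2 ((1 + s * 'i) / 2))
    (- (q ^+ 2 / 8) + 1 / 4 * (chi + s * 'i) * E).
Proof.
have [K [f [pcharK ker_f]]] := gauss_int_mod_prime _ p_prime.
have p_odd := prime_gt3_odd _ p_prime p_gt3.
pose J : gauss_int := GaussInt (imaginary_gauss_int _ s_sign).
have J2 : J ^+ 2 = -1.
  apply: val_inj; rewrite rmorphXn rmorphN1 /= exprMn sqrCi.
  by case: (s_sign) => ->; rewrite ?sqrrN expr1n mul1r.
have mJ2 : (- J) ^+ 2 = -1 by rewrite sqrrN.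
have fJ2 : f J ^+ 2 = -1 by rewrite -rmorphXn J2 rmorphN1.
have [n nE] := fermat_quotient2_nat _ p_prime (ltnW p_gt3).
move=> q chi E.
have q_n : reduces K p f q n%:R.
  rewrite /q /fermat_quotient -[2%:~R]/(2%:R) -natrX nE natrD addrK natrM mulfK.
    exact: reduces_nat.
  by rewrite pnatr_eq0 -lt0n prime_gt0.
have red_chi : reduces K p f chi ((-1) ^+ p./2).
  rewrite /chi legendreN1 //.
  by have := reduces_int K p f ((-1) ^+ p./2); rewrite !rmorphXn !rmorphN1.
have red_E : reduces K p f E (euler (p - 3))%:~R by exact: reduces_int.
have red_J : reduces K p f (s * 'i) (f J) by exact: (reduces_gauss K p f J).
have red_1J : reduces K p f (1 + s * 'i) (1 + f J) by apply: reducesD => //; exact: reduces1.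
pose v : K := 2%:R ^+ p.-2.
have cop2 : coprime 2 p by rewrite coprime2n.
have v2 : 2%:R * v = 1.
  by rewrite -exprS (_ : p.-2.+1 = p.-1) ?(expr_pred_pchar_natr _ _ pcharK) //; lia.
have red_V2 : reduces K p f 2^-1 v by exact: reduces_natV.
have red_V4 : reduces K p f 4^-1 (v ^+ 2).
  apply: (reduces_natV _ _ pcharK f 4); first exact: (coprimeXl 2 cop2).
  by rewrite (natrX K 2 2) -exprMn v2 expr1n.
have red_V8 : reduces K p f 8^-1 (v ^+ 3).
  apply: (reduces_natV _ _ pcharK f 8); first exact: (coprimeXl 3 cop2).
  by rewrite (natrX K 2 3) -exprMn v2 expr1n.
have red_1 := reduces1 K p f.
set c : K := (-1) ^+ p./2 in red_chi.
set Ek : K := (euler (p - 3))%:~R in red_E.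
have v8 (x : K) : x *+ 8 * v ^+ 3 = x.
  transitivity (x * (2%:R * v) ^+ 3); first by ring.
  by rewrite v2 expr1n mulr1.
split.
- apply: (reduces_eqmod _ _ pcharK f ker_f _ _ (polylogp K p 2).[1 + f J]).
    exact: reduces_polylog.
  (* With [v] the inverse of 2, the right side copies the shape of the target, so that the closure
     lemmas for [reduces] apply term by term. *)
  have -> : (polylogp K p 2).[1 + f J] =
      - (n%:R ^+ 2 * v ^+ 3) * (1 + f J * c) + 1 * v * c * Ek.
    rewrite -[LHS]v8 (polylogp2_1addJ _ _ pcharK p_gt3 _ n%:R) //; last first.
      exact: polylogp1_fermat_quotient.
    rewrite -/c -/Ek.
    transitivity (- (n%:R ^+ 2 * v ^+ 3) * (1 + f J * c) + (2%:R * v) ^+ 2 * v * c * Ek).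
      by ring.
    by rewrite v2 expr1n.
  apply: reducesD; last by do !apply: reducesM.
  apply: reducesM; first by apply/reducesN/reducesM => //; exact: reducesX.
  by apply: reducesD => //; exact: reducesM.
- apply: (reduces_eqmod _ _ pcharK f ker_f _ _ (polylogp K p 2).[(1 + f J) * v]).
    by apply: reduces_polylog => //; exact: reducesM.
  have -> : (polylogp K p 2).[(1 + f J) * v] =
      - (n%:R ^+ 2 * v ^+ 3) + 1 * v ^+ 2 * (c + f J) * Ek.
    rewrite -[LHS]v8 (polylogp2_half_1addJ _ _ pcharK p_gt3 (f J) n%:R) //; last 2 first.
    (* The inverted point needs the value at [f J], hence the use of [- J]. *)
    - have := polylogp1_fermat_quotient _ _ pcharK f p_gt3 (- J) n mJ2 nE.
      by rewrite rmorphN opprK mulrN.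
    - by rewrite -mulr_natl mulrCA v2 mulr1.
    rewrite -/c -/Ek.
    transitivity (- (n%:R ^+ 2 * v ^+ 3) + (2%:R * v) * v ^+ 2 * (c + f J) * Ek).
      by ring.
    by rewrite v2.
  apply: reducesD; first by apply/reducesN/reducesM => //; exact: reducesX.
  by do !apply: reducesM => //; exact: reducesD.
Qed.
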